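(* The system $\mathsf{DG}+\mathsf{PF\text{-}TP}_{\forall}$ proves $\mathsf{HBU}_C$. Here $\mathsf{PF\text{-}TP}_{\forall}$ is the schema $(\forall^{\mathrm{st}}\underline{x})\varphi(\underline{x})\rightarrow(\forall\underline{x})\varphi(\underline{x})$ for every internal $\varphi(\underline{x})$ whose free variables are all among $\underline{x}$ (no parameters allowed), and $\mathsf{HBU}_C$ is $(\forall G^{2})(\exists\langle\beta_0,\dots,\beta_k\rangle)(\forall\alpha\le_1 1)(\exists i\le k)\big(\alpha\in[\overline{\beta_i}\,G(\beta_i)]\big)$, where $\langle\beta_0,\dots,\beta_k\rangle$ is a finite sequence of type-1 objects and, for a finite binary sequence $\sigma$, $[\sigma]$ is the set of binary sequences $\alpha$ extending $\sigma$ (i.e. $\overline{\alpha}|\sigma|=\sigma$).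
   Context: Finite types: $0$ is a type and if $\rho,\sigma$ are types so is $\rho\to\sigma$; type $1=0\to0$, $2=1\to0$. $\mathsf{E\text{-}HA}^{\omega}$ is Heyting arithmetic in all finite types (intuitionistic logic, Gödel's $T$ constants) with extensionality. Equality $=_0$ is primitive; for $\tau=\tau_1\to\dots\to\tau_k\to0$, $x=_\tau y$ abbreviates $(\forall z_1\dots z_k)(xz_1\dots z_k=_0yz_1\dots z_k)$, and $\le_\tau$ likewise. Extensionality $(\mathsf E_{\rho\to\tau})$: $(\forall\varphi)(\forall x,y)(x=_\rho y\to\varphi(x)=_\tau\varphi(y))$, for all types. Binary sequences: $f\le_1 1$; $\overline{f}N=\langle f(0),\dots,f(N-1)\rangle$. Strong majorizability (Howard–Bezem): $x\le^*_0 y$ iff $x\le_0 y$; $x\le^*_{\rho\to\sigma}y$ iff for all $u,v$ with $u\le^*_\rho v$: $xu\le^*_\sigma yv$ and $yu\le^*_\sigma yv$. Monotone: $x\le^*x$; $\tilde\forall,\tilde\exists$ range over monotone objects. The language of $\mathsf{DG}$ adds predicates $\mathrm{st}^\sigma$ (''is standard''); $\forall^{\mathrm{st}},\exists^{\mathrm{st}}$ are the relativised quantifiers, $\tilde\forall^{\mathrm{st}},\tilde\exists^{\mathrm{st}}$ combine both restrictions. Internal = not containing $\mathrm{st}$. $\mathsf{DG}$ is $\mathsf{E\text{-}HA}^\omega$ in the extended language plus: (a) $x=_\sigma y\to(\mathrm{st}(x)\to\mathrm{st}(y))$; (b) $\mathrm{st}(y)\to(x\le^*_\sigma y\to\mathrm{st}(x))$;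 (c) $\mathrm{st}(t)$ for closed terms $t$; (d) $\mathrm{st}(z)\to(\mathrm{st}(x)\to\mathrm{st}(zx))$; external induction $\Phi(0)\wedge(\forall^{\mathrm{st}}n)(\Phi(n)\to\Phi(n+1))\to(\forall^{\mathrm{st}}n)\Phi(n)$ for any $\Phi$; and for arbitrary $\Phi,\Psi$ and internal $\phi,\psi$: $\mathsf{mAC}^\omega$: $(\tilde\forall^{\mathrm{st}}x)(\tilde\exists^{\mathrm{st}}y)\Phi(x,y)\to(\tilde\exists^{\mathrm{st}}f)(\tilde\forall^{\mathrm{st}}x)(\exists y\le^*f(x))\Phi(x,y)$; $\mathsf R^\omega$: $(\forall x)(\exists^{\mathrm{st}}y)\Phi(x,y)\to(\tilde\exists^{\mathrm{st}}z)(\forall x)(\exists y\le^*z)\Phi(x,y)$; $\mathsf I^\omega$: $(\tilde\forall^{\mathrm{st}}z)(\exists x)(\forall y\le^*z)\phi(x,y)\to(\exists x)(\forall^{\mathrm{st}}y)\phi(x,y)$; $\mathsf{IP}^\omega_{\tilde\forall^{\mathrm{st}}}$: $[(\tilde\forall^{\mathrm{st}}x)\phi(x)\to(\tilde\exists^{\mathrm{st}}y)\Psi(y)]\to(\tilde\exists^{\mathrm{st}}z)[(\tilde\forall^{\mathrm{st}}x)\phi(x)\to(\tilde\exists y\le^*z)\Psi(y)]$; $\mathsf M^\omega$: $[(\tilde\forall^{\mathrm{st}}x)\phi(x)\to\psi]\to(\tilde\exists^{\mathrm{st}}y)[(\forall x\le^*y)\phi(x)\to\psi]$; $\mathsf{MAJ}^\omega$: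 $(\forall^{\mathrm{st}}x)(\exists^{\mathrm{st}}y)(x\le^*y)$. *)

(* Defs.v *)
From Stdlib Require Import List.
Import ListNotations.

Set Implicit Arguments.
Unset Strict Implicit.

(** * Finite types, terms of Gödel's T, formulas with standardness predicates

    Syntax is intrinsically typed, with de Bruijn variables: [tm G s] and
    [form G] are the terms of type [s], resp. the formulas, whose free
    variables are listed with their types in [G], innermost binder first. *)

Inductive ty : Type :=
| O0 : ty
| Arr : ty -> ty -> ty.

Declare Scope ty_scope.
Delimit Scope ty_scope with ty.
Bind Scope ty_scope with ty.
Notation "s ~> t" := (Arr s t) (at level 55, right associativity) : ty_scope.

Definition ty1 : ty := (O0 ~> O0)%ty.
Definition ty2 : ty := (ty1 ~> O0)%ty.

Definition ctx : Type := list ty.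

Inductive var : ctx -> ty -> Type :=
| vz : forall (G : ctx) (s : ty), var (s :: G) s
| vs : forall (G : ctx) (s t : ty), var G s -> var (t :: G) s.

Arguments vz {G s}.
Arguments vs {G s t} _.

(** Combinators rather than lambda-abstraction, so terms bind nothing. *)
Inductive tm (G : ctx) : ty -> Type :=
| tvar : forall s, var G s -> tm G s
| tapp : forall s t, tm G (s ~> t) -> tm G s -> tm G t
| tzero : tm G O0
| tsucc : tm G (O0 ~> O0)
| tPi : forall r s, tm G (r ~> s ~> r)
| tSigma : forall r s t, tm G ((r ~> s ~> t) ~> (r ~> s) ~> r ~> t)
| tRec : forall r, tm G (r ~> (r ~> O0 ~> r) ~> O0 ~> r).

Arguments tvar {G s} _.
Arguments tapp {G s t} _ _.
Arguments tzero {G}.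
Arguments tsucc {G}.
Arguments tPi {G r s}.
Arguments tSigma {G r s t}.
Arguments tRec {G r}.

Declare Scope tm_scope.
Delimit Scope tm_scope with tm.
Bind Scope tm_scope with tm.
Notation "a $ b" := (tapp a b) (at level 40, left associativity) : tm_scope.

Inductive form : ctx -> Type :=
| fbot : forall G, form G
| feq : forall G, tm G O0 -> tm G O0 -> form G
| fstd : forall G s, tm G s -> form G
| fand : forall G, form G -> form G -> form G
| forr : forall G, form G -> form G -> form G
| fimp : forall G, form G -> form G -> form G
| fall : forall G s, form (s :: G) -> form G
| fex : forall G s, form (s :: G) -> form G.

Arguments fbot {G}.
Arguments fall {G} s _.
Arguments fex {G} s _.

Declare Scope form_scope.
Delimit Scope form_scope with form.
Bind Scope form_scope with form.
Notation "t =o u" := (feq t%tm u%tm) (at level 70, no associativity) : form_scope.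
Notation "A ∧' B" := (fand A B) (at level 80, right associativity) : form_scope.
Notation "A ∨' B" := (forr A B) (at level 85, right associativity) : form_scope.
Notation "A ⇒ B" := (fimp A B) (at level 90, right associativity) : form_scope.
Notation "∀' s , A" := (fall s A)
  (at level 200, s at level 60, A at level 200, right associativity) : form_scope.
Notation "∃' s , A" := (fex s A)
  (at level 200, s at level 60, A at level 200, right associativity) : form_scope.

Open Scope form_scope.

Fixpoint internal (G : ctx) (A : form G) : bool :=
  match A with
  | fbot => true
  | feq _ _ => true
  | fstd _ => false
  | fand A B | forr A B | fimp A B => andb (internal A) (internal B)
  | fall _ A | fex _ A => internal A
  end.

(** ** Renaming and substitution *)

Definition ren (G D : ctx) : Type := forall s, var G s -> var D s.
Definition sub (G D : ctx) : Type := forall s, var G s -> tm D s.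

Definition var_case (G : ctx) (t : ty) (P : ty -> Type)
    (pz : P t) (ps : forall s, var G s -> P s) (s : ty) (v : var (t :: G) s) : P s :=
  match v in var G' s'
        return match G' with
               | [] => unit
               | t' :: G'' => P t' -> (forall u, var G'' u -> P u) -> P s'
               end
  with
  | vz => fun pz _ => pz
  | vs w => fun _ ps => ps _ w
  end pz ps.

Definition shift (G : ctx) (t : ty) : ren G (t :: G) := fun _ v => vs v.

Definition up_ren (G D : ctx) (t : ty) (r : ren G D) : ren (t :: G) (t :: D) :=
  var_case (P := var (t :: D)) vz (fun _ v => vs (r _ v)).

Definition ren_closed (G : ctx) : ren [] G :=
  fun s v => match v in var G' _ return match G' with [] => var G s | _ => unit end with
             | vz => tt
             | vs _ => tt
             end.

Fixpoint tm_ren (G D : ctx) (r : ren G D) (s : ty) (a : tm G s) : tm D s :=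
  match a with
  | tvar v => tvar (r _ v)
  | tapp a b => tapp (tm_ren r a) (tm_ren r b)
  | tzero => tzero
  | tsucc => tsucc
  | tPi => tPi
  | tSigma => tSigma
  | tRec => tRec
  end.

Fixpoint form_ren (G D : ctx) (r : ren G D) (A : form G) : form D :=
  match A in form G return ren G D -> form D with
  | fbot => fun _ => fbot
  | feq a b => fun r => feq (tm_ren r a) (tm_ren r b)
  | fstd a => fun r => fstd (tm_ren r a)
  | fand A B => fun r => fand (form_ren r A) (form_ren r B)
  | forr A B => fun r => forr (form_ren r A) (form_ren r B)
  | fimp A B => fun r => fimp (form_ren r A) (form_ren r B)
  | fall s A => fun r => fall s (form_ren (up_ren (t := s) r) A)
  | fex s A => fun r => fex s (form_ren (up_ren (t := s) r) A)
  end r.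

Definition up_sub (G D : ctx) (t : ty) (f : sub G D) : sub (t :: G) (t :: D) :=
  var_case (P := tm (t :: D)) (tvar vz) (fun _ v => tm_ren (@shift D t) (f _ v)).

Fixpoint tm_sub (G D : ctx) (f : sub G D) (s : ty) (a : tm G s) : tm D s :=
  match a with
  | tvar v => f _ v
  | tapp a b => tapp (tm_sub f a) (tm_sub f b)
  | tzero => tzero
  | tsucc => tsucc
  | tPi => tPi
  | tSigma => tSigma
  | tRec => tRec
  end.

Fixpoint form_sub (G D : ctx) (f : sub G D) (A : form G) : form D :=
  match A in form G return sub G D -> form D with
  | fbot => fun _ => fbot
  | feq a b => fun f => feq (tm_sub f a) (tm_sub f b)
  | fstd a => fun f => fstd (tm_sub f a)
  | fand A B => fun f => fand (form_sub f A) (form_sub f B)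
  | forr A B => fun f => forr (form_sub f A) (form_sub f B)
  | fimp A B => fun f => fimp (form_sub f A) (form_sub f B)
  | fall s A => fun f => fall s (form_sub (up_sub (t := s) f) A)
  | fex s A => fun f => fex s (form_sub (up_sub (t := s) f) A)
  end f.

Definition tm_wk (G : ctx) (t s : ty) (a : tm G s) : tm (t :: G) s :=
  tm_ren (@shift G t) a.
Definition form_wk (G : ctx) (t : ty) (A : form G) : form (t :: G) :=
  form_ren (@shift G t) A.

(** [form_wk1], [form_wk2]: a fresh variable inserted just below the innermost
    one, resp. two, variables. *)
Definition form_wk1 (G : ctx) (t s : ty) (A : form (s :: G)) : form (s :: t :: G) :=
  form_ren (up_ren (t := s) (@shift G t)) A.
Definition form_wk2 (G : ctx) (t s1 s2 : ty) (A : form (s1 :: s2 :: G)) :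
    form (s1 :: s2 :: t :: G) :=
  form_ren (up_ren (t := s1) (up_ren (t := s2) (@shift G t))) A.

Definition tm_closed (G : ctx) (s : ty) (a : tm [] s) : tm G s :=
  tm_ren (@ren_closed G) a.
Definition form_closed (G : ctx) (A : form []) : form G :=
  form_ren (@ren_closed G) A.

Definition inst (G : ctx) (s : ty) (A : form (s :: G)) (a : tm G s) : form G :=
  form_sub (var_case (P := tm G) a (fun _ v => tvar v)) A.

(** [A(n)] becomes [A(n+1)], with [n] the innermost variable. *)
Definition inst_succ (G : ctx) (A : form (O0 :: G)) : form (O0 :: G) :=
  form_sub (var_case (P := tm (O0 :: G)) (tsucc $ tvar vz)%tm (fun _ v => tvar (vs v))) A.

Notation v0 := (tvar vz).
Notation v1 := (tvar (vs vz)).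
Notation v2 := (tvar (vs (vs vz))).
Notation v3 := (tvar (vs (vs (vs vz)))).
Notation v4 := (tvar (vs (vs (vs (vs vz))))).

(** ** Defined relations *)

Fixpoint eq_ty (s : ty) : forall G, tm G s -> tm G s -> form G :=
  match s with
  | O0 => fun G a b => a =o b
  | Arr s t => fun G a b => ∀' s, eq_ty (tm_wk s a $ v0)%tm (tm_wk s b $ v0)%tm
  end.

(** [x + 0 = x], [x + S n = S (x + n)]: the step [fun a n => S a] is
    [Sigma (Pi Pi) S]. *)
Definition tplus (G : ctx) (a b : tm G O0) : tm G O0 :=
  (tRec $ a $ (tSigma $ (tPi $ tPi) $ tsucc) $ b)%tm.

Definition le0 (G : ctx) (a b : tm G O0) : form G :=
  ∃' O0, tplus (tm_wk O0 a) v0 =o tm_wk O0 b.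

Definition lt0 (G : ctx) (a b : tm G O0) : form G := le0 (tsucc $ a)%tm b.

Fixpoint le_ty (s : ty) : forall G, tm G s -> tm G s -> form G :=
  match s with
  | O0 => fun G a b => le0 a b
  | Arr s t => fun G a b => ∀' s, le_ty (tm_wk s a $ v0)%tm (tm_wk s b $ v0)%tm
  end.

Fixpoint maj (s : ty) : forall G, tm G s -> tm G s -> form G :=
  match s with
  | O0 => fun G x y => le0 x y
  | Arr s t => fun G x y =>
      ∀' s, ∀' s, maj v1 v0 ⇒
        maj (tm_wk s (tm_wk s x) $ v1)%tm (tm_wk s (tm_wk s y) $ v0)%tm ∧'
        maj (tm_wk s (tm_wk s y) $ v1)%tm (tm_wk s (tm_wk s y) $ v0)%tm
  end.

Notation "x ≤* y" := (maj x%tm y%tm) (at level 70, no associativity) : form_scope.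

Definition monotone (G : ctx) (s : ty) (a : tm G s) : form G := a ≤* a.

Definition all_st (G : ctx) (s : ty) (A : form (s :: G)) : form G :=
  ∀' s, fstd v0 ⇒ A.
Definition ex_st (G : ctx) (s : ty) (A : form (s :: G)) : form G :=
  ∃' s, fstd v0 ∧' A.
Definition all_mon_st (G : ctx) (s : ty) (A : form (s :: G)) : form G :=
  ∀' s, fstd v0 ⇒ monotone v0 ⇒ A.
Definition ex_mon_st (G : ctx) (s : ty) (A : form (s :: G)) : form G :=
  ∃' s, fstd v0 ∧' monotone v0 ∧' A.

Arguments all_st {G} s A.
Arguments ex_st {G} s A.
Arguments all_mon_st {G} s A.
Arguments ex_mon_st {G} s A.

Notation "'∀st' s , A" := (all_st s A)
  (at level 200, s at level 60, A at level 200, right associativity) : form_scope.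
Notation "'∃st' s , A" := (ex_st s A)
  (at level 200, s at level 60, A at level 200, right associativity) : form_scope.
Notation "'∀~st' s , A" := (all_mon_st s A)
  (at level 200, s at level 60, A at level 200, right associativity) : form_scope.
Notation "'∃~st' s , A" := (ex_mon_st s A)
  (at level 200, s at level 60, A at level 200, right associativity) : form_scope.

(** * Theories and intuitionistic derivability

    A theory is a set of possibly open formulas; a member with free variables
    [G] is available for all values of these variables. *)

Definition theory : Type := forall G : ctx, form G -> Prop.

Definition theory_union (T U : theory) : theory := fun G A => T G A \/ U G A.

Inductive derives (T : theory) : forall G : ctx, list (form G) -> form G -> Prop :=
| d_ax : forall G H (A : form G), T G A -> derives T H A
| d_hyp : forall G H (A : form G), In A H -> derives T H A
| d_botE : forall G H (A : form G), derives T H fbot -> derives T H A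
| d_andI : forall G H (A B : form G),
    derives T H A -> derives T H B -> derives T H (A ∧' B)
| d_andE1 : forall G H (A B : form G), derives T H (A ∧' B) -> derives T H A
| d_andE2 : forall G H (A B : form G), derives T H (A ∧' B) -> derives T H B
| d_orI1 : forall G H (A B : form G), derives T H A -> derives T H (A ∨' B)
| d_orI2 : forall G H (A B : form G), derives T H B -> derives T H (A ∨' B)
| d_orE : forall G H (A B C : form G),
    derives T H (A ∨' B) -> derives T (A :: H) C -> derives T (B :: H) C ->
    derives T H C
| d_impI : forall G H (A B : form G), derives T (A :: H) B -> derives T H (A ⇒ B)
| d_impE : forall G H (A B : form G),
    derives T H (A ⇒ B) -> derives T H A -> derives T H B
| d_allI : forall G H s (A : form (s :: G)),
    derives T (map (@form_wk G s) H) A -> derives T H (∀' s, A)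
| d_allE : forall G H s (A : form (s :: G)) (a : tm G s),
    derives T H (∀' s, A) -> derives T H (inst A a)
| d_exI : forall G H s (A : form (s :: G)) (a : tm G s),
    derives T H (inst A a) -> derives T H (∃' s, A)
| d_exE : forall G H s (A : form (s :: G)) (C : form G),
    derives T H (∃' s, A) ->
    derives T (A :: map (@form_wk G s) H) (form_wk s C) ->
    derives T H C.

Definition proves (T : theory) (A : form []) : Prop := derives T [] A.

(** * E-HA^omega

    The logic and the axioms are over the extended language, but induction is
    for internal formulas only: full induction would give [forall n, st n]. *)

Inductive EHA_omega : theory :=
| eha_eq_refl : forall G (x : tm G O0), EHA_omega (x =o x)
| eha_eq_sym : forall G (x y : tm G O0), EHA_omega (x =o y ⇒ y =o x)
| eha_eq_trans : forall G (x y z : tm G O0),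
    EHA_omega (x =o y ∧' y =o z ⇒ x =o z)
| eha_succ_inj : forall G (x y : tm G O0),
    EHA_omega (tsucc $ x =o tsucc $ y ⇒ x =o y)
| eha_succ_zero : forall G (x : tm G O0),
    EHA_omega (tsucc $ x =o tzero ⇒ fbot)
| eha_ind : forall G (A : form (O0 :: G)),
    internal A = true ->
    EHA_omega (inst A tzero ∧' (∀' O0, A ⇒ inst_succ A) ⇒ ∀' O0, A)
| eha_Pi : forall G r s (x : tm G r) (y : tm G s),
    EHA_omega (eq_ty (tPi $ x $ y)%tm x)
| eha_Sigma : forall G r s t (x : tm G (r ~> s ~> t)) (y : tm G (r ~> s)) (z : tm G r),
    EHA_omega (eq_ty (tSigma $ x $ y $ z)%tm (x $ z $ (y $ z))%tm)
| eha_Rec_zero : forall G r (x : tm G r) (y : tm G (r ~> O0 ~> r)),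
    EHA_omega (eq_ty (tRec $ x $ y $ tzero)%tm x)
| eha_Rec_succ : forall G r (x : tm G r) (y : tm G (r ~> O0 ~> r)) (n : tm G O0),
    EHA_omega (eq_ty (tRec $ x $ y $ (tsucc $ n))%tm (y $ (tRec $ x $ y $ n) $ n)%tm)
| eha_ext : forall G r t (f : tm G (r ~> t)) (x y : tm G r),
    EHA_omega (eq_ty x y ⇒ eq_ty (f $ x)%tm (f $ y)%tm).

(** * DG

    In a matrix with variables [x, y], [y] is [v0] and [x] is [v1]. *)

Inductive DG : theory :=
| dg_eha : forall G (A : form G), EHA_omega A -> DG A
| dg_st_eq : forall G s (x y : tm G s), DG (eq_ty x y ⇒ fstd x ⇒ fstd y)
| dg_st_maj : forall G s (x y : tm G s), DG (fstd y ⇒ x ≤* y ⇒ fstd x)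
| dg_st_closed : forall G s (t : tm [] s), DG (fstd (tm_closed G t))
| dg_st_app : forall G s t (z : tm G (s ~> t)) (x : tm G s),
    DG (fstd z ⇒ fstd x ⇒ fstd (z $ x)%tm)
| dg_ext_ind : forall G (A : form (O0 :: G)),
    DG (inst A tzero ∧' (∀st O0, A ⇒ inst_succ A) ⇒ ∀st O0, A)
| dg_mAC : forall G s t (A : form (t :: s :: G)),
    DG ((∀~st s, ∃~st t, A) ⇒
        ∃~st (s ~> t), ∀~st s, ∃' t, v0 ≤* v2 $ v1 ∧' form_wk2 (s ~> t) A)
| dg_R : forall G s t (A : form (t :: s :: G)),
    DG ((∀' s, ∃st t, A) ⇒ ∃~st t, ∀' s, ∃' t, v0 ≤* v2 ∧' form_wk2 t A)
| dg_I : forall G s t (A : form (t :: s :: G)),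
    internal A = true ->
    DG ((∀~st t, ∃' s, ∀' t, v0 ≤* v2 ⇒ form_wk2 t A) ⇒ ∃' s, ∀st t, A)
| dg_IP : forall G s t (A : form (s :: G)) (B : form (t :: G)),
    internal A = true ->
    DG (((∀~st s, A) ⇒ ∃~st t, B) ⇒
        ∃~st t, (∀~st s, form_wk1 t A) ⇒
                ∃' t, monotone v0 ∧' v0 ≤* v1 ∧' form_wk1 t B)
| dg_M : forall G s (A : form (s :: G)) (B : form G),
    internal A = true -> internal B = true ->
    DG (((∀~st s, A) ⇒ B) ⇒
        ∃~st s, (∀' s, v0 ≤* v1 ⇒ form_wk1 s A) ⇒ form_wk s B)
| dg_MAJ : forall G s, DG (G := G) (∀st s, ∃st s, v1 ≤* v0).

(** * PF-TP_forall *)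

Fixpoint all_closure (G : ctx) : form G -> form [] :=
  match G with
  | [] => fun A => A
  | s :: G' => fun A => all_closure (∀' s, A)
  end.

Fixpoint all_st_closure (G : ctx) : form G -> form [] :=
  match G with
  | [] => fun A => A
  | s :: G' => fun A => all_st_closure (∀st s, A)
  end.

(** [A : form X] has all its free variables among [X]; the resulting sentence
    may be used in any context. *)
Inductive PF_TP_all : theory :=
| pf_tp : forall G (X : ctx) (A : form X),
    internal A = true ->
    PF_TP_all (form_closed G (all_st_closure A ⇒ all_closure A)).

(** * HBU_C

    The type structure has no sequence types: a finite sequence of objects of
    type [s] is given by its length and a function [0 -> s], of which only the
    entries below the length matter. *)

Record fseq (G : ctx) (s : ty) : Type := FSeq {
  flen : tm G O0;
  fent : tm G (O0 ~> s)
}.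

Definition fseq_eq (G : ctx) (s : ty) (u v : fseq G s) : form G :=
  flen u =o flen v ∧'
  ∀' O0, lt0 v0 (tm_wk O0 (flen u)) ⇒
    eq_ty (tm_wk O0 (fent u) $ v0)%tm (tm_wk O0 (fent v) $ v0)%tm.

(** [<f(0), ..., f(n-1)>] *)
Definition initseg (G : ctx) (f : tm G ty1) (n : tm G O0) : fseq G O0 := FSeq n f.

Definition one1 (G : ctx) : tm G ty1 := (tPi $ (tsucc $ tzero))%tm.

Definition binary (G : ctx) (f : tm G ty1) : form G := le_ty f (one1 G).

(** [alpha] belongs to the cone [[u]]. *)
Definition in_cone (G : ctx) (alpha : tm G ty1) (u : fseq G O0) : form G :=
  binary alpha ∧' fseq_eq (initseg alpha (flen u)) u.

(** [<beta_0, ..., beta_k>] is quantified as [k] and [beta]; in the matrix, [v0],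
    ..., [v4] are [i], [alpha], [beta], [k] and the type-2 object. *)
Definition HBU_C : form [] :=
  ∀' ty2, ∃' O0, ∃' (O0 ~> ty1), ∀' ty1, binary v0 ⇒
    ∃' O0, le0 v0 v3 ∧' in_cone v1 (initseg (v2 $ v0)%tm (v4 $ (v2 $ v0))%tm).

(* Main.v *)
(** Every binary sequence is standard, being strongly majorized by the constant
    sequence 1. Hence a standard [F] of type 2 takes standard values on Cantor
    space, and the axiom [R] bounds them by a single [n]. It remains to cover
    Cantor space by the cones of length [n] around the sequences [bits i] of
    binary digits of [i], for the [i] below some [k]: [k] is found by internal
    induction on [n], prefixing a digit being [i |-> 2i] or [i |-> 2i + 1].
    The resulting cover exists for all standard [F], thus for all [F] by
    [PF_TP_all]. *)

From Stdlib Require Import List Setoid Morphisms.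
Require Import Defs.
Import ListNotations.

Set Implicit Arguments.
Unset Strict Implicit.

(** * Calculus of renaming and substitution *)

Lemma tm_sub_ext (G D : ctx) (f g : sub G D) (s : ty) (a : tm G s) :
  (forall u (v : var G u), f u v = g u v) -> tm_sub f a = tm_sub g a.
Proof. intros E; induction a; simpl; rewrite ?E, ?IHa1, ?IHa2; reflexivity. Qed.

Lemma tm_ren_ext (G D : ctx) (f g : ren G D) (s : ty) (a : tm G s) :
  (forall u (v : var G u), f u v = g u v) -> tm_ren f a = tm_ren g a.
Proof. intros E; induction a; simpl; rewrite ?E, ?IHa1, ?IHa2; reflexivity. Qed.

Lemma tm_sub_id (G : ctx) (s : ty) (a : tm G s) : tm_sub (fun _ v => tvar v) a = a.
Proof. induction a; simpl; rewrite ?IHa1, ?IHa2; reflexivity. Qed.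

Lemma tm_sub_ren (G D E : ctx) (r : ren G D) (f : sub D E) (s : ty) (a : tm G s) :
  tm_sub f (tm_ren r a) = tm_sub (fun _ v => f _ (r _ v)) a.
Proof. induction a; simpl; rewrite ?IHa1, ?IHa2; reflexivity. Qed.

Lemma tm_ren_ren (G D E : ctx) (r : ren G D) (f : ren D E) (s : ty) (a : tm G s) :
  tm_ren f (tm_ren r a) = tm_ren (fun _ v => f _ (r _ v)) a.
Proof. induction a; simpl; rewrite ?IHa1, ?IHa2; reflexivity. Qed.

Lemma tm_ren_sub (G D E : ctx) (f : sub G D) (r : ren D E) (s : ty) (a : tm G s) :
  tm_ren r (tm_sub f a) = tm_sub (fun _ v => tm_ren r (f _ v)) a.
Proof. induction a; simpl; rewrite ?IHa1, ?IHa2; reflexivity. Qed.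

(** A weakened term does not mention the variable that receives [x]. Through this equation [inst]
    leaves parameters of a formula untouched. *)
Lemma tm_sub_case_wk (G D : ctx) (t s : ty) (x : tm D t) (f : sub G D) (a : tm G s) :
  tm_sub (var_case (P := tm D) x f) (tm_wk t a) = tm_sub f a.
Proof. unfold tm_wk; rewrite tm_sub_ren; apply tm_sub_ext; reflexivity. Qed.

Lemma tm_sub_shift (G : ctx) (t s : ty) (a : tm G s) :
  tm_sub (fun _ v => tvar (vs (t := t) v)) a = tm_wk t a.
Proof. unfold tm_wk; induction a; simpl; rewrite ?IHa1, ?IHa2; reflexivity. Qed.

Lemma tm_sub_up_wk (G D : ctx) (t s : ty) (f : sub G D) (a : tm G s) :
  tm_sub (up_sub (t := t) f) (tm_wk t a) = tm_wk t (tm_sub f a).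
Proof.
  unfold tm_wk; rewrite tm_sub_ren, tm_ren_sub; apply tm_sub_ext; reflexivity.
Qed.

Lemma tm_ren_up_wk (G D : ctx) (t s : ty) (r : ren G D) (a : tm G s) :
  tm_ren (up_ren (t := t) r) (tm_wk t a) = tm_wk t (tm_ren r a).
Proof.
  unfold tm_wk; rewrite !tm_ren_ren; apply tm_ren_ext; reflexivity.
Qed.

Lemma tm_wk_app (G : ctx) (r s t : ty) (a : tm G (s ~> t)) (b : tm G s) :
  tm_wk r (a $ b)%tm = (tm_wk r a $ tm_wk r b)%tm.
Proof. reflexivity. Qed.

Lemma tm_ren_shift (G : ctx) (t s : ty) (a : tm G s) :
  tm_ren (@shift G t) a = tm_wk t a.
Proof. reflexivity. Qed.

Create HintDb syn.
Hint Rewrite tm_sub_case_wk tm_sub_id tm_sub_shift tm_sub_up_wk tm_ren_up_wk tm_wk_app tm_ren_shift : syn.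

(** The quantifier rules produce goals of the form [inst A a] and [form_wk s A]. This tactic pushes
    the substitution down to the terms and, by one commutation lemma for each defined predicate,
    keeps these predicates folded. *)
Ltac syn :=
  unfold inst, inst_succ, form_wk, form_wk1, form_wk2;
  repeat (progress (cbn [map form_sub form_ren tm_sub tm_ren var_case];
    autorewrite with syn)).

Tactic Notation "syn" "in" hyp(X) :=
  unfold inst, inst_succ, form_wk, form_wk1, form_wk2 in X;
  repeat (progress (cbn [map form_sub form_ren tm_sub tm_ren var_case] in X;
    autorewrite with syn in X)).

Lemma form_sub_eq_ty (s : ty) : forall (G D : ctx) (f : sub G D) (a b : tm G s),
  form_sub f (eq_ty a b) = eq_ty (tm_sub f a) (tm_sub f b).
Proof.
  induction s as [|s _ t IH]; intros; simpl; [reflexivity|].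
  rewrite IH; syn; reflexivity.
Qed.

Lemma form_ren_eq_ty (s : ty) : forall (G D : ctx) (f : ren G D) (a b : tm G s),
  form_ren f (eq_ty a b) = eq_ty (tm_ren f a) (tm_ren f b).
Proof.
  induction s as [|s _ t IH]; intros; simpl; [reflexivity|].
  rewrite IH; syn; reflexivity.
Qed.

Lemma tplus_sub (G D : ctx) (f : sub G D) (a b : tm G O0) :
  tm_sub f (tplus a b) = tplus (tm_sub f a) (tm_sub f b).
Proof. reflexivity. Qed.

Lemma tplus_ren (G D : ctx) (f : ren G D) (a b : tm G O0) :
  tm_ren f (tplus a b) = tplus (tm_ren f a) (tm_ren f b).
Proof. reflexivity. Qed.

Hint Rewrite form_sub_eq_ty form_ren_eq_ty tplus_sub tplus_ren : syn.

Lemma le0_sub (G D : ctx) (f : sub G D) (a b : tm G O0) :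
  form_sub f (le0 a b) = le0 (tm_sub f a) (tm_sub f b).
Proof. unfold le0; syn; reflexivity. Qed.

Lemma le0_ren (G D : ctx) (f : ren G D) (a b : tm G O0) :
  form_ren f (le0 a b) = le0 (tm_ren f a) (tm_ren f b).
Proof. unfold le0; syn; reflexivity. Qed.

Lemma lt0_sub (G D : ctx) (f : sub G D) (a b : tm G O0) :
  form_sub f (lt0 a b) = lt0 (tm_sub f a) (tm_sub f b).
Proof. apply le0_sub. Qed.

Lemma lt0_ren (G D : ctx) (f : ren G D) (a b : tm G O0) :
  form_ren f (lt0 a b) = lt0 (tm_ren f a) (tm_ren f b).
Proof. apply le0_ren. Qed.

Hint Rewrite le0_sub le0_ren lt0_sub lt0_ren : syn.

Lemma binary_sub (G D : ctx) (f : sub G D) (a : tm G ty1) :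
  form_sub f (binary a) = binary (tm_sub f a).
Proof. unfold binary; simpl le_ty; syn; reflexivity. Qed.

Lemma binary_ren (G D : ctx) (f : ren G D) (a : tm G ty1) :
  form_ren f (binary a) = binary (tm_ren f a).
Proof. unfold binary; simpl le_ty; syn; reflexivity. Qed.

Hint Rewrite binary_sub binary_ren : syn.

(** * Derived rules *)

(** Arithmetic and the cover are derived in [EHA_omega], standardness in [DG]; this carries both
    into the larger theories. *)
Lemma derives_mono (T U : theory) (HTU : forall G (A : form G), T G A -> U G A)
    (G : ctx) (H : list (form G)) (A : form G) :
  derives T H A -> derives U H A.
Proof.
  induction 1;
    [ apply d_ax; auto | apply d_hyp; auto | apply d_botE | apply d_andI | eapply d_andE1
    | eapply d_andE2 | apply d_orI1 | apply d_orI2 | eapply d_orE | apply d_impI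
    | eapply d_impE | apply d_allI | apply d_allE | eapply d_exI | eapply d_exE ]; eauto.
Qed.

(** Once in the hypothesis list, a formula is weakened by [d_allI] and [d_exE] as they pass a
    binder; this takes the place of a weakening lemma for derivations. Chains of [d_impE] over
    [d_impI] do the same for several formulas. *)
Lemma d_cut (T : theory) (G : ctx) (H : list (form G)) (A B : form G) :
  derives T H A -> derives T (A :: H) B -> derives T H B.
Proof. intros HA HB; exact (d_impE (d_impI HB) HA). Qed.

Ltac hyp := solve [apply d_hyp; simpl; auto 20].

Lemma ind (G : ctx) (H : list (form G)) (A : form (O0 :: G)) (n : tm G O0) :
  internal A = true -> derives EHA_omega H (inst A tzero) ->
  derives EHA_omega (A :: map (@form_wk G O0) H) (inst_succ A) ->
  derives EHA_omega H (inst A n).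
Proof.
  intros IA H0 HS. apply d_allE.
  eapply d_impE; [apply d_ax, eha_ind, IA|].
  apply d_andI; [exact H0 | apply d_allI, d_impI, HS].
Qed.

(** * Equality at all types *)

Definition deq (G : ctx) (H : list (form G)) (s : ty) (a b : tm G s) : Prop :=
  derives EHA_omega H (eq_ty a b).

Lemma deq_app_l (G : ctx) (H : list (form G)) (s t : ty) (f g : tm G (s ~> t)) (a : tm G s) :
  deq H f g -> deq H (f $ a) (g $ a).
Proof.
  intros E. change (derives EHA_omega H (∀' s, eq_ty (tm_wk s f $ v0)%tm (tm_wk s g $ v0)%tm)) in E.
  pose proof (d_allE a E) as X. syn in X. exact X.
Qed.

Lemma deq_app_r (G : ctx) (H : list (form G)) (s t : ty) (f : tm G (s ~> t)) (a b : tm G s) :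
  deq H a b -> deq H (f $ a) (f $ b).
Proof. intros E. eapply d_impE; [apply d_ax, eha_ext | exact E]. Qed.

Lemma deq_refl (s : ty) : forall (G : ctx) (H : list (form G)) (a : tm G s), deq H a a.
Proof.
  induction s as [|s _ t IH]; intros G H a; [apply d_ax, eha_eq_refl|].
  apply d_allI, IH.
Qed.

Lemma eq_ty_hyp_v0 (G : ctx) (H : list (form G)) (s t : ty) (a b : tm G (s ~> t)) :
  In (eq_ty a b) H ->
  deq (map (@form_wk G s) H) (tm_wk s a $ v0)%tm (tm_wk s b $ v0)%tm.
Proof.
  intros I. apply deq_app_l, d_hyp.
  apply (in_map (@form_wk G s)) in I. syn in I. exact I.
Qed.

(** Stated for a hypothesis rather than a derivable equality, since membership in the list survives
    the weakening that [d_allI] performs at arrow types. A cut then gives the general form. *)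
Lemma deq_sym_hyp (s : ty) : forall (G : ctx) (H : list (form G)) (a b : tm G s),
  In (eq_ty a b) H -> deq H b a.
Proof.
  induction s as [|s _ t IH]; intros G H a b I.
  - eapply d_impE; [apply d_ax, eha_eq_sym | apply d_hyp, I].
  - apply d_allI. eapply d_cut; [exact (eq_ty_hyp_v0 I) | apply IH; left; reflexivity].
Qed.

Lemma deq_trans_hyp (s : ty) : forall (G : ctx) (H : list (form G)) (a b c : tm G s),
  In (eq_ty a b) H -> In (eq_ty b c) H -> deq H a c.
Proof.
  induction s as [|s _ t IH]; intros G H a b c I J.
  - eapply d_impE; [apply d_ax, eha_eq_trans | apply d_andI; apply d_hyp; [exact I|exact J]].
  - apply d_allI.
    refine (d_impE (d_impE (d_impI (d_impI _)) (eq_ty_hyp_v0 I)) (eq_ty_hyp_v0 J)).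
    eapply IH; simpl; eauto.
Qed.

Lemma deq_sym (G : ctx) (H : list (form G)) (s : ty) (a b : tm G s) : deq H a b -> deq H b a.
Proof. intros E. eapply d_cut; [exact E | apply deq_sym_hyp; left; reflexivity]. Qed.

Lemma deq_trans (G : ctx) (H : list (form G)) (s : ty) (a b c : tm G s) :
  deq H a b -> deq H b c -> deq H a c.
Proof.
  intros E F. refine (d_impE (d_impE (d_impI (d_impI _)) E) F).
  eapply deq_trans_hyp; simpl; eauto.
Qed.

Instance deq_equiv (G : ctx) (H : list (form G)) (s : ty) : Equivalence (@deq G H s).
Proof.
  split; [intros a; apply deq_refl | intros a b; apply deq_sym | intros a b c; apply deq_trans].
Qed.

(** Congruence in the argument is the extensionality axiom, congruence in the function is the
    meaning of equality at arrow types. With it [rewrite] works inside object-level terms. *)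
Instance tapp_deq (G : ctx) (H : list (form G)) (s t : ty) :
  Proper (@deq G H (s ~> t) ==> @deq G H s ==> @deq G H t) (@tapp G s t).
Proof.
  intros f g E a b F. transitivity (f $ b)%tm; [apply deq_app_r, F | apply deq_app_l, E].
Qed.

Instance tplus_deq (G : ctx) (H : list (form G)) :
  Proper (@deq G H O0 ==> @deq G H O0 ==> @deq G H O0) (@tplus G).
Proof. intros a b E c d F. unfold tplus. rewrite E, F. reflexivity. Qed.

Lemma Pi_eq (G : ctx) (H : list (form G)) (r s : ty) (x : tm G r) (y : tm G s) :
  deq H (tPi $ x $ y)%tm x.
Proof. apply d_ax, eha_Pi. Qed.

Lemma Sigma_eq (G : ctx) (H : list (form G)) (r s t : ty) (x : tm G (r ~> s ~> t))
    (y : tm G (r ~> s)) (z : tm G r) :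
  deq H (tSigma $ x $ y $ z)%tm (x $ z $ (y $ z))%tm.
Proof. apply d_ax, eha_Sigma. Qed.

Lemma Rec_zero (G : ctx) (H : list (form G)) (r : ty) (x : tm G r)
    (y : tm G (r ~> O0 ~> r)) : deq H (tRec $ x $ y $ tzero)%tm x.
Proof. apply d_ax, eha_Rec_zero. Qed.

Lemma Rec_succ (G : ctx) (H : list (form G)) (r : ty) (x : tm G r)
    (y : tm G (r ~> O0 ~> r)) (n : tm G O0) :
  deq H (tRec $ x $ y $ (tsucc $ n))%tm (y $ (tRec $ x $ y $ n) $ n)%tm.
Proof. apply d_ax, eha_Rec_succ. Qed.

(** * Programs in Gödel's T *)

Definition comp (G : ctx) (r s t : ty) (f : tm G (s ~> t)) (g : tm G (r ~> s)) : tm G (r ~> t) :=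
  (tSigma $ (tPi $ f) $ g)%tm.

(** The step [comp tPi f] applies [f] and drops the counter of the recursion. *)
Definition iter (G : ctx) (s : ty) (x : tm G s) (f : tm G (s ~> s)) : tm G (O0 ~> s) :=
  (tRec $ x $ comp tPi f)%tm.

Definition isz (G : ctx) : tm G (O0 ~> O0) := iter (tsucc $ tzero)%tm (tPi $ tzero)%tm.

Definition sg (G : ctx) : tm G (O0 ~> O0) := comp (isz G) (isz G).

Definition dbl (G : ctx) : tm G (O0 ~> O0) := iter tzero (comp tsucc tsucc).

Definition parity (G : ctx) : tm G (O0 ~> O0) := iter tzero (isz G).

(** Sums up the parities below: [half (S n) = half n + parity n]. *)
Definition half (G : ctx) : tm G (O0 ~> O0) :=
  (tRec $ tzero $ (tSigma $ comp tSigma (comp tPi (tSigma $ tRec $ (tPi $ comp tPi tsucc)))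
                          $ (tPi $ parity G)))%tm.

(** [bits i] is the binary expansion of [i], least significant digit first. *)
Definition bits (G : ctx) : tm G (O0 ~> ty1) :=
  comp (tSigma $ (tPi $ parity G))%tm (tSigma $ tRec $ (tPi $ comp tPi (half G)))%tm.

Section Equations.
Context (G : ctx) (H : list (form G)).

Lemma comp_eq (r s t : ty) (f : tm G (s ~> t)) (g : tm G (r ~> s)) (a : tm G r) :
  deq H (comp f g $ a)%tm (f $ (g $ a))%tm.
Proof. unfold comp. rewrite Sigma_eq, Pi_eq. reflexivity. Qed.

Lemma iter_zero (s : ty) (x : tm G s) (f : tm G (s ~> s)) : deq H (iter x f $ tzero)%tm x.
Proof. apply Rec_zero. Qed.

Lemma iter_succ (s : ty) (x : tm G s) (f : tm G (s ~> s)) (n : tm G O0) :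
  deq H (iter x f $ (tsucc $ n))%tm (f $ (iter x f $ n))%tm.
Proof. unfold iter. rewrite Rec_succ, comp_eq, Pi_eq. reflexivity. Qed.

Lemma plus_zero (a : tm G O0) : deq H (tplus a tzero) a.
Proof. apply Rec_zero. Qed.

Lemma plus_succ (a b : tm G O0) : deq H (tplus a (tsucc $ b)%tm) (tsucc $ tplus a b)%tm.
Proof. apply iter_succ. Qed.

Lemma isz_zero : deq H (isz G $ tzero)%tm (tsucc $ tzero)%tm.
Proof. apply iter_zero. Qed.

Lemma isz_succ (n : tm G O0) : deq H (isz G $ (tsucc $ n))%tm tzero.
Proof. unfold isz. rewrite iter_succ. apply Pi_eq. Qed.

Lemma sg_zero : deq H (sg G $ tzero)%tm tzero.
Proof. unfold sg. rewrite comp_eq, isz_zero. apply isz_succ. Qed.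

Lemma sg_succ (n : tm G O0) : deq H (sg G $ (tsucc $ n))%tm (tsucc $ tzero)%tm.
Proof. unfold sg. rewrite comp_eq, isz_succ. apply isz_zero. Qed.

Lemma dbl_zero : deq H (dbl G $ tzero)%tm tzero.
Proof. apply iter_zero. Qed.

Lemma dbl_succ (n : tm G O0) : deq H (dbl G $ (tsucc $ n))%tm (tsucc $ (tsucc $ (dbl G $ n)))%tm.
Proof. unfold dbl. rewrite iter_succ, comp_eq. reflexivity. Qed.

Lemma parity_zero : deq H (parity G $ tzero)%tm tzero.
Proof. apply iter_zero. Qed.

Lemma parity_succ (n : tm G O0) : deq H (parity G $ (tsucc $ n))%tm (isz G $ (parity G $ n))%tm.
Proof. apply iter_succ. Qed.

Lemma half_zero : deq H (half G $ tzero)%tm tzero.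
Proof. apply Rec_zero. Qed.

Lemma half_succ (n : tm G O0) :
  deq H (half G $ (tsucc $ n))%tm (tplus (half G $ n)%tm (parity G $ n)%tm).
Proof.
  unfold half. rewrite Rec_succ, Sigma_eq, Pi_eq, !comp_eq, Sigma_eq, Pi_eq, Sigma_eq, Pi_eq.
  reflexivity.
Qed.

Lemma bits_eq (i j : tm G O0) :
  deq H (bits G $ i $ j)%tm (parity G $ (iter i (half G) $ j))%tm.
Proof. unfold bits. rewrite comp_eq, !Sigma_eq, !Pi_eq. reflexivity. Qed.

End Equations.

Lemma iter_sub (G D : ctx) (h : sub G D) (s : ty) (x : tm G s) (f : tm G (s ~> s)) :
  tm_sub h (iter x f) = iter (tm_sub h x) (tm_sub h f).
Proof. reflexivity. Qed.

Hint Rewrite iter_sub : syn.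

Definition tail (G : ctx) (a : tm G ty1) : tm G ty1 := comp a tsucc.
(** As [a] ranges over all sequences, [clip a] ranges, up to extensional equality, over all of
    Cantor space. Bounded quantification over binary sequences thus becomes plain quantification,
    the form that [dg_R] asks for. *)
Definition clip (G : ctx) (a : tm G ty1) : tm G ty1 := comp (sg G) a.

Lemma tail_sub (G D : ctx) (h : sub G D) (a : tm G ty1) : tm_sub h (tail a) = tail (tm_sub h a).
Proof. reflexivity. Qed.

Lemma clip_wk (G : ctx) (t : ty) (a : tm G ty1) : tm_wk t (clip a) = clip (tm_wk t a).
Proof. reflexivity. Qed.

Hint Rewrite tail_sub clip_wk : syn.

Ltac to_deq :=
  match goal with |- derives EHA_omega ?H (?a =o ?b) => change (deq H a b) end.

Ltac hyps_of_goal :=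
  match goal with |- deq ?H _ _ => constr:(H) | |- derives _ ?H _ => constr:(H) end.

(* The motive [A] is written with [v0] in place of the term [n]. Where the induction hypothesis goes
   without use, this is a case distinction on [n]. *)
Tactic Notation "induct" uconstr(A) uconstr(n) :=
  let H := hyps_of_goal in
  let X := fresh in
  assert (X : derives EHA_omega H (inst A n));
  [ apply ind; [reflexivity | syn; try to_deq | syn; try to_deq]
  | syn in X; exact X ].

(* Setoid rewriting must not see the hypothesis list, in which the same terms may occur. *)
Ltac hide_hyps :=
  match goal with |- deq ?H _ _ =>
    let K := fresh "K" in set (K := H) in *; clearbody K
  end.

(** Turns the equation at the head of the list, usually an induction hypothesis, into a rewrite rule
    before the list is made opaque. *)
Ltac head_eq E :=
  match goal with |- deq ((?a =o ?b) :: ?H) _ _ =>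
    let K := fresh "K" in
    set (K := (a =o b) :: H);
    assert (E : deq K a b) by (apply d_hyp; left; reflexivity);
    clearbody K
  end.

(** * Addition, doubling, parity and binary digits *)

Section Arithmetic.
Context (G : ctx) (H : list (form G)).

Lemma plus_succ_l (a b : tm G O0) : deq H (tplus (tsucc $ a)%tm b) (tsucc $ tplus a b)%tm.
Proof.
  induct (tplus (tsucc $ tm_wk O0 a) v0 =o tsucc $ tplus (tm_wk O0 a) v0) b.
  - rewrite !plus_zero. reflexivity.
  - head_eq E. rewrite !plus_succ, E. reflexivity.
Qed.

Lemma plus_assoc (a b c : tm G O0) : deq H (tplus (tplus a b) c) (tplus a (tplus b c)).
Proof.
  induct (tplus (tplus (tm_wk O0 a) (tm_wk O0 b)) v0
          =o tplus (tm_wk O0 a) (tplus (tm_wk O0 b) v0)) c.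
  - rewrite !plus_zero. reflexivity.
  - head_eq E. rewrite !plus_succ, E. reflexivity.
Qed.

Lemma dbl_plus (a b : tm G O0) : deq H (dbl G $ tplus a b)%tm (tplus (dbl G $ a)%tm (dbl G $ b)%tm).
Proof.
  induct (dbl (O0 :: G) $ tplus (tm_wk O0 a) v0
          =o tplus (dbl (O0 :: G) $ tm_wk O0 a) (dbl (O0 :: G) $ v0)) b.
  - rewrite plus_zero, dbl_zero, plus_zero. reflexivity.
  - head_eq E. rewrite plus_succ, !dbl_succ, !plus_succ, E. reflexivity.
Qed.

Lemma parity_dbl (n : tm G O0) : deq H (parity G $ (dbl G $ n))%tm tzero.
Proof.
  induct (parity (O0 :: G) $ (dbl (O0 :: G) $ v0) =o tzero) n.
  - rewrite dbl_zero. apply parity_zero.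
  - head_eq E. rewrite dbl_succ, !parity_succ, E, isz_zero. apply isz_succ.
Qed.

Lemma parity_succ_dbl (n : tm G O0) :
  deq H (parity G $ (tsucc $ (dbl G $ n)))%tm (tsucc $ tzero)%tm.
Proof. rewrite parity_succ, parity_dbl. apply isz_zero. Qed.

Lemma sg_parity (n : tm G O0) : deq H (sg G $ (parity G $ n))%tm (parity G $ n)%tm.
Proof.
  induct (sg (O0 :: G) $ (parity (O0 :: G) $ v0) =o parity (O0 :: G) $ v0) n.
  - rewrite parity_zero. apply sg_zero.
  (* The parity of a successor is a value of [isz], which is 0 or 1 at every argument [p]; a case
     distinction on [p] follows. *)
  - rewrite !parity_succ. generalize (parity (O0 :: G) $ v0)%tm. intros p.
    hide_hyps.
    induct (sg (O0 :: O0 :: G) $ (isz (O0 :: O0 :: G) $ v0) =o isz (O0 :: O0 :: G) $ v0) p.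
    + rewrite isz_zero. apply sg_succ.
    + rewrite isz_succ. apply sg_zero.
Qed.

(** The recursion peels [f] off the outside. [bits_succ] needs it peeled off the inside, so that
    dropping the first digit of [i] amounts to halving [i]. *)
Lemma iter_comm (x : tm G O0) (f : tm G (O0 ~> O0)) (n : tm G O0) :
  deq H (iter (f $ x)%tm f $ n)%tm (f $ (iter x f $ n))%tm.
Proof.
  induct (iter (tm_wk O0 f $ tm_wk O0 x)%tm (tm_wk O0 f) $ v0
          =o tm_wk O0 f $ (iter (tm_wk O0 x) (tm_wk O0 f) $ v0)) n.
  - rewrite !iter_zero. reflexivity.
  - head_eq E. rewrite !iter_succ, E. reflexivity.
Qed.

Lemma bits_zero (i : tm G O0) : deq H (bits G $ i $ tzero)%tm (parity G $ i)%tm.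
Proof. rewrite bits_eq, iter_zero. reflexivity. Qed.

Lemma bits_succ (i j : tm G O0) :
  deq H (bits G $ i $ (tsucc $ j))%tm (bits G $ (half G $ i) $ j)%tm.
Proof. rewrite !bits_eq, iter_succ, iter_comm. reflexivity. Qed.

End Arithmetic.

Lemma half_dbl (G : ctx) (H : list (form G)) (n : tm G O0) : deq H (half G $ (dbl G $ n))%tm n.
Proof.
  induct (half (O0 :: G) $ (dbl (O0 :: G) $ v0) =o v0) n.
  - rewrite dbl_zero. apply half_zero.
  - head_eq E.
    (* As [half] sums up parities, the two steps from 2n to 2n + 2 add 0 and 1. *)
    rewrite dbl_succ, !half_succ, parity_succ_dbl, parity_dbl, E, plus_zero, plus_succ, plus_zero.
    reflexivity.
Qed.

Lemma half_succ_dbl (G : ctx) (H : list (form G)) (n : tm G O0) :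
  deq H (half G $ (tsucc $ (dbl G $ n)))%tm n.
Proof. rewrite half_succ, parity_dbl, half_dbl. apply plus_zero. Qed.

Lemma clip_bits (G : ctx) (H : list (form G)) (i : tm G O0) :
  deq H (clip (bits G $ i)%tm) (bits G $ i)%tm.
Proof.
  apply d_allI. change (eq_ty (s := O0)) with (fun G (a b : tm G O0) => a =o b); cbv beta.
  syn. to_deq. unfold clip. rewrite comp_eq, bits_eq. apply sg_parity.
Qed.

(** * Order *)

Lemma le0_intro (G : ctx) (H : list (form G)) (a b c : tm G O0) :
  deq H (tplus a c) b -> derives EHA_omega H (le0 a b).
Proof. intros E. apply (d_exI (a := c)). syn. exact E. Qed.

Lemma le0_deq (G : ctx) (H : list (form G)) (a a' b b' : tm G O0) :
  deq H a a' -> deq H b b' -> derives EHA_omega H (le0 a b) -> derives EHA_omega H (le0 a' b').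
Proof.
  intros E F L.
  refine (d_impE (d_impE (d_impE (d_impI (d_impI (d_impI _))) E) F) L).
  eapply d_exE; [apply d_hyp; left; reflexivity|]. cbn [eq_ty]. syn. apply (le0_intro (c := v0)).
  match goal with |- deq ?K _ _ =>
    assert (E1 : deq K (tm_wk O0 a) (tm_wk O0 a')) by (unfold deq; cbn [eq_ty]; hyp);
    assert (E2 : deq K (tm_wk O0 b) (tm_wk O0 b')) by (unfold deq; cbn [eq_ty]; hyp);
    assert (E3 : deq K (tplus (tm_wk O0 a) v0) (tm_wk O0 b)) by (unfold deq; cbn [eq_ty]; hyp)
  end.
  hide_hyps. rewrite <- E1, <- E2. exact E3.
Qed.

Lemma le0_trans (G : ctx) (H : list (form G)) (a b c : tm G O0) :
  derives EHA_omega H (le0 a b) -> derives EHA_omega H (le0 b c) -> derives EHA_omega H (le0 a c).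
Proof.
  intros L M. refine (d_impE (d_impE (d_impI (d_impI _)) L) M).
  eapply d_exE; [apply d_hyp; left; reflexivity|]. syn.
  eapply d_exE; [apply d_hyp; right; right; left; reflexivity|]. syn.
  (* The differences add up: [v0] leads from [a] to [b], and [v1] from [b] to [c]. *)
  apply (le0_intro (c := tplus v0 v1)).
  match goal with |- deq ?K (tplus ?a _) ?c =>
    assert (E : deq K (tplus a v0) (tm_wk O0 (tm_wk O0 b))) by (unfold deq; cbn [eq_ty]; hyp);
    assert (F : deq K (tplus (tm_wk O0 (tm_wk O0 b)) v1) c) by (unfold deq; cbn [eq_ty]; hyp)
  end.
  hide_hyps. rewrite <- plus_assoc, E. exact F.
Qed.

Lemma le0_refl (G : ctx) (H : list (form G)) (a : tm G O0) : derives EHA_omega H (le0 a a).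
Proof. apply (le0_intro (c := tzero)). apply plus_zero. Qed.

Lemma le0_succ (G : ctx) (H : list (form G)) (a b : tm G O0) :
  derives EHA_omega H (le0 (tsucc $ a)%tm (tsucc $ b)%tm) -> derives EHA_omega H (le0 a b).
Proof.
  intros L. eapply d_cut; [exact L|].
  eapply d_exE; [apply d_hyp; left; reflexivity|]. syn. apply (le0_intro (c := v0)).
  eapply d_impE; [apply d_ax, eha_succ_inj|]. to_deq.
  head_eq E. rewrite <- plus_succ_l. exact E.
Qed.

Lemma dbl_le (G : ctx) (H : list (form G)) (a b : tm G O0) :
  derives EHA_omega H (le0 a b) ->
  derives EHA_omega H (le0 (dbl G $ a)%tm (dbl G $ b)%tm).
Proof.
  intros L. eapply d_cut; [exact L|].
  eapply d_exE; [apply d_hyp; left; reflexivity|]. syn.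
  apply (le0_intro (c := (dbl (O0 :: G) $ v0)%tm)). head_eq E.
  rewrite <- dbl_plus, E. reflexivity.
Qed.

Lemma le0_succ_succ (G : ctx) (H : list (form G)) (a b : tm G O0) :
  derives EHA_omega H (le0 a b) -> derives EHA_omega H (le0 (tsucc $ a)%tm (tsucc $ b)%tm).
Proof.
  intros L. eapply d_cut; [exact L|].
  eapply d_exE; [apply d_hyp; left; reflexivity|]. syn.
  apply (le0_intro (c := v0)). head_eq E.
  rewrite plus_succ_l, E. reflexivity.
Qed.

(** By cases on the difference: if it is zero, the sum is [a] itself; if it is a successor, so is
    the sum, which then cannot be zero. *)
Lemma le0_zero (G : ctx) (H : list (form G)) (a : tm G O0) :
  derives EHA_omega H (le0 a tzero) -> deq H a tzero.
Proof.
  intros L. eapply d_cut; [exact L|].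
  eapply d_exE; [apply d_hyp; left; reflexivity|]. cbn [eq_ty]. syn.
  eapply d_impE; [|apply d_hyp; left; reflexivity].
  match goal with |- derives _ ?K _ => generalize K end. intros K.
  generalize (tm_wk O0 a). intros b. generalize (v0 : tm (O0 :: G) O0). intros c.
  induct (tplus (tm_wk O0 b) v0 =o tzero ⇒ tm_wk O0 b =o tzero) c.
  - apply d_impI. to_deq. head_eq E. rewrite plus_zero in E. exact E.
  - apply d_impI, d_botE. eapply d_impE; [apply d_ax, eha_succ_zero|].
    to_deq. head_eq E. rewrite plus_succ in E. exact E.
Qed.

Lemma le0_one (G : ctx) (H : list (form G)) (a : tm G O0) :
  derives EHA_omega H (le0 a (tsucc $ tzero)%tm) ->
  derives EHA_omega H (a =o tzero ∨' a =o tsucc $ tzero).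
Proof.
  intros L. eapply d_impE; [|exact L].
  induct (le0 v0 (tsucc $ tzero)%tm ⇒ v0 =o tzero ∨' v0 =o tsucc $ tzero) a.
  - apply d_impI, d_orI1, d_ax, eha_eq_refl.
  - apply d_impI, d_orI2. to_deq. apply deq_app_r, le0_zero, le0_succ.
    apply d_hyp; left; reflexivity.
Qed.

Lemma zero_le (G : ctx) (H : list (form G)) (a : tm G O0) : derives EHA_omega H (le0 tzero a).
Proof.
  induct (le0 tzero v0) a; [apply le0_refl|].
  eapply d_exE; [apply d_hyp; left; reflexivity|]. syn.
  apply (le0_intro (c := (tsucc $ v0)%tm)). head_eq E. rewrite plus_succ, E. reflexivity.
Qed.

Lemma sg_le_one (G : ctx) (H : list (form G)) (a : tm G O0) :
  derives EHA_omega H (le0 (sg G $ a)%tm (tsucc $ tzero)%tm).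
Proof.
  induct (le0 (sg (O0 :: G) $ v0)%tm (tsucc $ tzero)%tm) a.
  - eapply le0_deq; [symmetry; apply sg_zero | reflexivity | apply zero_le].
  - eapply le0_deq; [symmetry; apply sg_succ | reflexivity | apply le0_refl].
Qed.

(** * A finite cover of Cantor space *)

Lemma binary_elim (G : ctx) (H : list (form G)) (a : tm G ty1) (n : tm G O0) :
  derives EHA_omega H (binary a) -> derives EHA_omega H (le0 (a $ n)%tm (tsucc $ tzero)%tm).
Proof.
  intros B. change (derives EHA_omega H
    (∀' O0, le0 (tm_wk O0 a $ v0)%tm (tm_wk O0 (one1 G) $ v0)%tm)) in B.
  pose proof (d_allE n B) as X. syn in X.
  eapply le0_deq; [reflexivity | apply Pi_eq | exact X].
Qed.

Lemma binary_intro (G : ctx) (H : list (form G)) (a : tm G ty1) :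
  derives EHA_omega (map (@form_wk G O0) H) (le0 (tm_wk O0 a $ v0)%tm (tsucc $ tzero)%tm) ->
  derives EHA_omega H (binary a).
Proof.
  intros B. apply d_allI. eapply le0_deq; [reflexivity | symmetry; apply Pi_eq | exact B].
Qed.

Lemma binary_tail (G : ctx) (H : list (form G)) (a : tm G ty1) :
  derives EHA_omega H (binary a) -> derives EHA_omega H (binary (tail a)).
Proof.
  intros B. eapply d_cut; [exact B|]. apply binary_intro. syn.
  eapply le0_deq; [symmetry; apply comp_eq | reflexivity |].
  apply binary_elim, d_hyp; left; reflexivity.
Qed.

(** Equality of initial segments of length [n] without the comparison of lengths in [fseq_eq], which
    [in_cone_intro] restores. *)
Definition agree (G : ctx) (a b : tm G ty1) (n : tm G O0) : form G :=
  ∀' O0, lt0 v0 (tm_wk O0 n) ⇒ tm_wk O0 a $ v0 =o tm_wk O0 b $ v0.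

Lemma agree_sub (G D : ctx) (f : sub G D) (a b : tm G ty1) (n : tm G O0) :
  form_sub f (agree a b n) = agree (tm_sub f a) (tm_sub f b) (tm_sub f n).
Proof. unfold agree; syn; reflexivity. Qed.

Lemma agree_ren (G D : ctx) (f : ren G D) (a b : tm G ty1) (n : tm G O0) :
  form_ren f (agree a b n) = agree (tm_ren f a) (tm_ren f b) (tm_ren f n).
Proof. unfold agree; syn; reflexivity. Qed.

Hint Rewrite agree_sub agree_ren : syn.

Lemma agree_elim (G : ctx) (H : list (form G)) (a b : tm G ty1) (n j : tm G O0) :
  derives EHA_omega H (agree a b n) -> derives EHA_omega H (lt0 j n) ->
  deq H (a $ j)%tm (b $ j)%tm.
Proof.
  intros A L. pose proof (d_allE j A) as X. syn in X. exact (d_impE X L).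
Qed.

Lemma agree_le (G : ctx) (H : list (form G)) (a b : tm G ty1) (m n : tm G O0) :
  derives EHA_omega H (agree a b n) -> derives EHA_omega H (le0 m n) ->
  derives EHA_omega H (agree a b m).
Proof.
  intros A L. refine (d_impE (d_impE (d_impI (d_impI _)) A) L).
  apply d_allI, d_impI. syn. to_deq. apply agree_elim with (n := tm_wk O0 n); [hyp|].
  apply le0_trans with (b := tm_wk O0 m); hyp.
Qed.

(** At position zero the digit of [i'] is its parity; at a successor the digits are those of
    [half i' = i], which [tail a] follows. The premises are implications so that the motive of the
    induction on [j] contains them. *)
Lemma agree_bits_succ_at (G : ctx) (H : list (form G)) (a : tm G ty1) (i i' n j : tm G O0) :
  derives EHA_omega H (agree (tail a) (bits G $ i)%tm n ⇒
    a $ tzero =o parity G $ i' ⇒ half G $ i' =o i ⇒ lt0 j (tsucc $ n)%tm ⇒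
    a $ j =o bits G $ i' $ j).
Proof.
  induct (agree (tail (tm_wk O0 a)) (bits _ $ tm_wk O0 i)%tm (tm_wk O0 n) ⇒
    tm_wk O0 a $ tzero =o parity _ $ tm_wk O0 i' ⇒ half _ $ tm_wk O0 i' =o tm_wk O0 i ⇒
    lt0 v0 (tsucc $ tm_wk O0 n)%tm ⇒ tm_wk O0 a $ v0 =o bits _ $ tm_wk O0 i' $ v0) j;
    do 4 apply d_impI; to_deq.
  - match goal with |- deq ?K _ _ =>
      assert (P : deq K (a $ tzero)%tm (parity _ $ i')%tm) by hyp
    end.
    hide_hyps. rewrite bits_zero. exact P.
  - match goal with |- deq ?K _ _ =>
      assert (Q : deq K (half _ $ tm_wk O0 i')%tm (tm_wk O0 i)) by hyp;
      assert (F : deq K (tail (tm_wk O0 a) $ v0)%tm (bits _ $ tm_wk O0 i $ v0)%tm)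
    end.
    (* Since [lt0] is [le0] from a successor, cancelling one successor turns [j + 1 < n + 1] into
       [j < n]. *)
    { apply agree_elim with (n := tm_wk O0 n); [hyp|]. apply le0_succ. hyp. }
    hide_hyps. rewrite bits_succ, Q, <- F. unfold tail. rewrite comp_eq. reflexivity.
Qed.

Lemma agree_bits_succ (G : ctx) (H : list (form G)) (a : tm G ty1) (i i' n : tm G O0) :
  derives EHA_omega H (agree (tail a) (bits G $ i)%tm n) ->
  deq H (a $ tzero)%tm (parity G $ i')%tm -> deq H (half G $ i')%tm i ->
  derives EHA_omega H (agree a (bits G $ i')%tm (tsucc $ n)%tm).
Proof.
  intros A P Q. refine (d_impE (d_impE (d_impE (d_impI (d_impI (d_impI _))) A) P) Q).
  apply d_allI, d_impI. cbn [eq_ty]. syn.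
  refine (d_impE (d_impE (d_impE (d_impE (agree_bits_succ_at _ _ (tm_wk O0 i) _ (tm_wk O0 n) _) _) _) _) _);
    hyp.
Qed.

(** The first digit of [a] is 0 or 1, so prefixing it to [i] gives 2i or 2i + 1; both are at most 2k
    + 1. *)
Lemma cover_step (G : ctx) (H : list (form G)) (a : tm G ty1) (i k n : tm G O0) :
  derives EHA_omega H (binary a) -> derives EHA_omega H (le0 i k) ->
  derives EHA_omega H (agree (tail a) (bits G $ i)%tm n) ->
  derives EHA_omega H (∃' O0, le0 v0 (tm_wk O0 (tsucc $ (dbl G $ k)))%tm ∧'
    agree (tm_wk O0 a) (bits _ $ v0)%tm (tm_wk O0 (tsucc $ n)%tm)).
Proof.
  intros B L A.
  refine (d_impE (d_impE (d_impE (d_impI (d_impI (d_impI _))) B) L) A).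
  eapply d_orE.
  { apply le0_one with (a := (a $ tzero)%tm), binary_elim. hyp. }
  - apply (d_exI (a := (dbl G $ i)%tm)). syn. apply d_andI.
    + eapply le0_trans; [apply dbl_le with (b := k); hyp|].
      apply (le0_intro (c := (tsucc $ tzero)%tm)). hide_hyps.
      rewrite plus_succ, plus_zero. reflexivity.
    + apply agree_bits_succ with (i := i); [hyp | | apply half_dbl].
      head_eq E. rewrite parity_dbl. exact E.
  - apply (d_exI (a := (tsucc $ (dbl G $ i))%tm)). syn. apply d_andI.
    + apply le0_succ_succ, dbl_le; hyp.
    + apply agree_bits_succ with (i := i); [hyp | | apply half_succ_dbl].
      head_eq E. rewrite parity_succ_dbl. exact E.
Qed.

(** The witnesses are 0 for length zero and 2k + 1 at each step, so the bound amounts to 2^n - 1.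
    The formula is internal, hence the induction reaches every [n], standard or not. *)
Lemma cantor_cover (G : ctx) (H : list (form G)) (n : tm G O0) :
  derives EHA_omega H (∃' O0, ∀' ty1, binary v0 ⇒
    ∃' O0, le0 v0 v2 ∧' agree v1 (bits _ $ v0)%tm (tm_wk O0 (tm_wk ty1 (tm_wk O0 n)))).
Proof.
  induct (∃' O0, ∀' ty1, binary v0 ⇒ ∃' O0, le0 v0 v2 ∧' agree v1 (bits _ $ v0)%tm v3) n.
  (* Length zero leaves no position to compare: [j + 1 <= 0] is absurd. *)
  - apply (d_exI (a := tzero)). syn. apply d_allI, d_impI, (d_exI (a := tzero)). syn.
    apply d_andI; [apply le0_refl|]. apply d_allI, d_impI. syn. apply d_botE.
    eapply d_impE; [apply d_ax, eha_succ_zero|]. apply le0_zero. apply d_hyp; left; reflexivity.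
  - eapply d_exE; [apply d_hyp; left; reflexivity|]. syn.
    apply (d_exI (a := (tsucc $ (dbl _ $ v0))%tm)). syn.
    apply d_allI, d_impI. syn.
    match goal with |- derives _ ?K _ =>
      assert (X : derives EHA_omega K (∀' ty1, binary v0 ⇒
         ∃' O0, le0 v0 v3 ∧' agree v1 (bits _ $ v0)%tm v4)) by hyp
    end.
    (* The cover of length [n] serves the tail of the sequence; [cover_step] puts the first digit
       back. *)
    apply (d_allE (tail v0)) in X. syn in X.
    eapply d_exE.
    { eapply d_impE; [exact X | apply binary_tail, d_hyp; left; reflexivity]. }
    syn.
    match goal with |- derives _ ?K _ =>
      pose proof (cover_step (H := K) (a := v1) (i := v0) (k := v2) (n := v3)) as S
    end.
    syn in S. apply S.
    + hyp.
    + eapply d_andE1, d_hyp; left; reflexivity.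
    + eapply d_andE2, d_hyp; left; reflexivity.
Qed.

(** * Cones, and covers obtained from a bound on Cantor space *)

Lemma in_cone_sub (G D : ctx) (f : sub G D) (a b : tm G ty1) (n : tm G O0) :
  form_sub f (in_cone a (initseg b n))
  = in_cone (tm_sub f a) (initseg (tm_sub f b) (tm_sub f n)).
Proof. unfold in_cone, fseq_eq, initseg; cbn [flen fent eq_ty]; syn; reflexivity. Qed.

Lemma in_cone_ren (G D : ctx) (f : ren G D) (a b : tm G ty1) (n : tm G O0) :
  form_ren f (in_cone a (initseg b n))
  = in_cone (tm_ren f a) (initseg (tm_ren f b) (tm_ren f n)).
Proof. unfold in_cone, fseq_eq, initseg; cbn [flen fent eq_ty]; syn; reflexivity. Qed.

Hint Rewrite in_cone_sub in_cone_ren : syn.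

Lemma in_cone_intro (G : ctx) (H : list (form G)) (a b : tm G ty1) (n : tm G O0) :
  derives EHA_omega H (binary a) -> derives EHA_omega H (agree a b n) ->
  derives EHA_omega H (in_cone a (initseg b n)).
Proof.
  intros B A. apply d_andI; [exact B | apply d_andI; [apply d_ax, eha_eq_refl | exact A]].
Qed.

(** The body of [HBU_C] with the functional as a parameter: quantified over [v0], it is [HBU_C] up
    to conversion. *)
Definition covered (G : ctx) (F : tm G ty2) : form G :=
  ∃' O0, ∃' (O0 ~> ty1), ∀' ty1, binary v0 ⇒
    ∃' O0, le0 v0 v3 ∧' in_cone v1 (initseg (v2 $ v0)%tm
      (tm_wk _ (tm_wk _ (tm_wk _ (tm_wk _ F))) $ (v2 $ v0))%tm).

Definition clip_bounded (G : ctx) (F : tm G ty2) (n : tm G O0) : form G :=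
  ∀' ty1, le0 (tm_wk ty1 F $ clip v0)%tm (tm_wk ty1 n).

Lemma clip_bounded_ren (G D : ctx) (f : ren G D) (F : tm G ty2) (n : tm G O0) :
  form_ren f (clip_bounded F n) = clip_bounded (tm_ren f F) (tm_ren f n).
Proof. unfold clip_bounded; syn; reflexivity. Qed.

Hint Rewrite clip_bounded_ren : syn.

(** By extensionality [F] takes the same value at [bits i] and at its clipped version, to which the
    bound applies. *)
Lemma bounded_on_bits (G : ctx) (H : list (form G)) (F : tm G ty2) (i n : tm G O0) :
  derives EHA_omega H (clip_bounded F n) ->
  derives EHA_omega H (le0 (F $ (bits G $ i))%tm n).
Proof.
  intros B. pose proof (d_allE (bits G $ i)%tm B) as X. syn in X.
  eapply le0_deq; [apply deq_app_r, clip_bits | reflexivity | exact X].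
Qed.

(** The cones of length [n] are contained in the required ones: [F (bits i)] is at most [n], so
    agreement up to [n] gives agreement up to [F (bits i)]. *)
Lemma covered_of_bounded (G : ctx) (H : list (form G)) (F : tm G ty2) (n : tm G O0) :
  derives EHA_omega H (clip_bounded F n) -> derives EHA_omega H (covered F).
Proof.
  intros B. eapply d_cut; [exact B|].
  eapply d_exE; [apply cantor_cover with (n := n)|]. unfold covered. syn.
  (* The length bound comes from [cantor_cover], and [bits] itself lists the points of the cover. *)
  apply (d_exI (a := v0)). syn. apply (d_exI (a := bits _)). syn.
  apply d_allI, d_impI. syn.
  match goal with |- derives _ ?K _ =>
    assert (X : derives EHA_omega K (∀' ty1, binary v0 ⇒ ∃' O0, le0 v0 v3 ∧'
      agree v1 (bits _ $ v0)%tm (tm_wk _ (tm_wk _ (tm_wk _ (tm_wk _ n)))))) by hyp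
  end.
  apply (d_allE v0) in X. syn in X.
  eapply d_exE; [eapply d_impE; [exact X | hyp]|]. syn.
  apply (d_exI (a := v0)). syn.
  apply d_andI; [eapply d_andE1, d_hyp; left; reflexivity|].
  apply in_cone_intro; [hyp|].
  eapply agree_le; [eapply d_andE2, d_hyp; left; reflexivity|].
  apply bounded_on_bits. hyp.
Qed.

(** * Standardness *)

(** Values of [sg] are at most 1. Strong majorization also asks that the constant sequence 1
    majorize itself, which is the second conjunct. Nothing is assumed of [a], so nonstandard
    sequences are included. *)
Lemma clip_maj (G : ctx) (H : list (form G)) (a : tm G ty1) :
  derives EHA_omega H (maj (clip a) (one1 G)).
Proof.
  apply d_allI, d_allI, d_impI. syn. cbn [maj].
  apply d_andI.
  - eapply le0_deq; [symmetry; apply comp_eq | symmetry; apply Pi_eq | apply sg_le_one].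
  - eapply le0_deq; [symmetry; apply Pi_eq | symmetry; apply Pi_eq | apply le0_refl].
Qed.

(* Every clipped sequence is standard, being majorized by the closed term [one1]. *)
Lemma clip_st (G : ctx) (H : list (form G)) (a : tm G ty1) : derives DG H (fstd (clip a)).
Proof.
  eapply d_impE; [eapply d_impE; [apply d_ax, dg_st_maj|]|].
  - exact (d_ax _ (dg_st_closed G (one1 []))).
  - exact (derives_mono dg_eha (clip_maj H a)).
Qed.

Lemma st_clip_bounded (G : ctx) (H : list (form G)) (F : tm G ty2) :
  derives DG H (fstd F) -> derives DG H (∃' O0, clip_bounded (tm_wk O0 F) v0).
Proof.
  intros S.
  (* The relation given to [dg_R] is the graph of the functional on clipped sequences. At type 0
     majorization is the usual order, so the result is a common bound. *)
  pose proof (d_ax H (dg_R (s := ty1) (t := O0) (tm_wk O0 (tm_wk ty1 F) $ clip v1 =o v0))) as R.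
  unfold all_mon_st, ex_mon_st, all_st, ex_st, monotone in R. cbn [maj] in R. syn in R.
  eapply d_exE; [eapply d_impE; [exact R|]|].
  (* The standard witness is the value itself: [F] and [clip a] are standard, and so is their
     application. *)
  - eapply d_cut; [exact S|]. apply d_allI, (d_exI (a := (tm_wk ty1 F $ clip v0)%tm)). syn.
    apply d_andI; [|apply d_ax, dg_eha, eha_eq_refl].
    eapply d_impE; [eapply d_impE; [apply d_ax, dg_st_app | hyp] | apply clip_st].
  - syn. apply (derives_mono dg_eha).
    apply (d_exI (a := v0)). syn.
    match goal with |- derives _ ?K _ =>
      assert (X : derives EHA_omega K (∀' ty1, ∃' O0, le0 v0 v2 ∧'
        tm_wk _ (tm_wk _ (tm_wk _ F)) $ clip v1 =o v0))
    end.
    { eapply d_andE2, d_andE2, d_hyp; left; reflexivity. }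
    eapply d_cut; [exact X|]. apply d_allI. syn.
    eapply d_exE.
    { match goal with |- derives _ ?K _ =>
        assert (Y : derives EHA_omega K (∀' ty1, ∃' O0, le0 v0 v3 ∧'
          tm_wk _ (tm_wk _ (tm_wk _ (tm_wk _ F))) $ clip v1 =o v0)) by hyp
      end.
      apply (d_allE v0) in Y. syn in Y. exact Y. }
    syn.
    eapply le0_deq; [symmetry; eapply (d_andE2 (A := le0 v0 v2)) | reflexivity | eapply d_andE1];
      apply d_hyp; left; reflexivity.
Qed.

Theorem theorem3p7 : proves (theory_union DG PF_TP_all) HBU_C.
Proof.
  assert (P : theory_union DG PF_TP_all
    ((∀st ty2, covered (v0 : tm [ty2] ty2)) ⇒ ∀' ty2, covered (v0 : tm [ty2] ty2))).
  (* The formula is internal and its only free variable is the functional, so transfer without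
     parameters applies. *)
  { right. exact (pf_tp [] (X := [ty2]) (A := covered v0) eq_refl). }
  refine (d_impE (d_ax _ P) _).
  (* There remains the case of a standard functional, which [DG] settles by itself. *)
  apply (derives_mono (T := DG)); [intros G A; left; assumption|].
  apply d_allI, d_impI.
  eapply d_exE; [apply st_clip_bounded, d_hyp; left; reflexivity|]. syn.
  apply (derives_mono dg_eha).
  refine (covered_of_bounded (F := v1) (n := v0) _). apply d_hyp; left; reflexivity.
Qed.
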